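(* Let $d\ge2$ and let $\rho$ be a random pure state drawn from the Haar measure on $\mathbb{C}^d\otimes\mathbb{C}^d$. Then the expectation of the Wasserstein entanglement measure satisfies $$\mathbb{E}\bigl[\mathcal{E}(\rho)\bigr]\;\ge\;\frac{\pi}{4}\Bigl(1-\frac1d\Bigr).$$
   Context: Here $\rho=|\psi\rangle\langle\psi|$ with $|\psi\rangle$ uniformly (unitarily invariantly) distributed on the unit sphere of $\mathbb{C}^d\otimes\mathbb{C}^d$. Let $\mathcal{H}_A=\mathcal{H}_B=\mathbb{C}^{d}$, $\mathcal{H}_{AB}=\mathcal{H}_A\otimes\mathcal{H}_B$. Write $\mathcal{D}(\mathcal{H})$ for the density operators on $\mathcal{H}$, $\|\cdot\|_{op}$ for the operator norm, and $\mathcal{SEP}(\mathcal{H}_{AB})$ for the set of separable states (convex combinations of product states $\sigma_A\otimes\sigma_B$). Fix a family $\{F_i^A\}_{i=1}^{d^2-1}$ of traceless Hermitian $d\times d$ matrices with $\operatorname{Tr}(F_i^AF_j^A)=\delta_{ij}$ and $\|F_i^A\|_{op}\le1$, and similarly a family $\{F_j^B\}_{j=1}^{d^2-1}$ for $B$. Let $\mathcal{K}_0=\{F_i^A\otimes I_B\}_i\cup\{I_A\otimes F_j^B\}_j$. On two copies $\mathcal{H}_{AB}^{(1)}\otimes\mathcal{H}_{AB}^{(2)}$ of $\mathcal{H}_{AB}$ define the cost operator $$C=\sum_{X\in\mathcal{K}_0}\bigl(X\otimes I_{AB}^{(2)}-I_{AB}^{(1)}\otimes X\bigr)^2 .$$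 For $\rho,\sigma\in\mathcal{D}(\mathcal{H}_{AB})$ let $\Pi(\rho,\sigma)$ be the set of density operators on $\mathcal{H}_{AB}^{(1)}\otimes\mathcal{H}_{AB}^{(2)}$ with marginals $\rho$ and $\sigma$. The quantum Wasserstein distance of order 1 is $W_1(\rho,\sigma)=\bigl(\inf_{\tau\in\Pi(\rho,\sigma)}\operatorname{Tr}[C\tau]\bigr)^{1/2}$, and the Wasserstein entanglement measure is $$\mathcal{E}(\rho)=\inf_{\sigma\in\mathcal{SEP}(\mathcal{H}_{AB})}W_1(\rho,\sigma).$$ *)

(* Defs.v *)
From mathcomp Require Import all_boot all_order all_algebra.
From mathcomp Require Import all_classical all_reals all_analysis.
From mathcomp.real_closed Require Import mxtens complex.

Set Implicit Arguments.
Unset Strict Implicit.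
Unset Printing Implicit Defensive.

Import Order.TTheory GRing.Theory Num.Theory.
Import numFieldNormedType.Exports.
Import ComplexField.Normc.

Local Open Scope ring_scope.
Local Open Scope classical_set_scope.
Local Open Scope complex_scope.
Local Open Scope sesquilinear_scope.

(* Tensor products are Kronecker products, [A *t B]: the product basis vector
   e_i (x) e_j of C^m (x) C^n is the basis vector of C^(m * n) with index
   [mxtens_index (i, j)]. *)

(* K^n with its Borel sigma-algebra (product topology). It is stated for a
   [numFieldType] because [R[i]] gets a topology only through that structure. *)
Definition cvec (K : numFieldType) (n : nat) : Type :=
  g_sigma_algebraType (@open 'cV[K]_n).

Section States.
Context {R : realType}.
Implicit Types m n d : nat.

Definition l2norm n (v : 'cV[R[i]]_n) : R :=
  Num.sqrt (\sum_(i < n) normc (v i 0) ^+ 2).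

Definition opnorm n (A : 'M[R[i]]_n) : R :=
  sup [set l2norm (A *m v) | v in [set v : 'cV[R[i]]_n | l2norm v <= 1]].

(* In [R[i]], [0 <= z] means that z is real and nonnegative. *)
Definition density n (rho : 'M[R[i]]_n) : Prop :=
  [/\ rho \is hermsymmx,
      forall v : 'cV[R[i]]_n, 0 <= (v^t* *m rho *m v) 0 0
    & \tr rho = 1].

Definition pure_state n (psi : 'cV[R[i]]_n) : 'M[R[i]]_n := psi *m psi^t*.

Definition marginal1 m n (tau : 'M[R[i]]_(m * n)) : 'M[R[i]]_m :=
  \matrix_(i, j) \sum_(k < n) tau (mxtens_index (i, k)) (mxtens_index (j, k)).

Definition marginal2 m n (tau : 'M[R[i]]_(m * n)) : 'M[R[i]]_n :=
  \matrix_(i, j) \sum_(k < m) tau (mxtens_index (k, i)) (mxtens_index (k, j)).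

Definition coupling n (rho sigma : 'M[R[i]]_n) : set 'M[R[i]]_(n * n) :=
  [set tau | [/\ density tau, marginal1 tau = rho & marginal2 tau = sigma]].

Definition separable d : set 'M[R[i]]_(d * d) :=
  [set sigma | exists (n : nat) (p : 'I_n -> R) (a b : 'I_n -> 'M[R[i]]_d),
     [/\ forall k, 0 <= p k,
         \sum_k p k = 1,
         forall k, density (a k) /\ density (b k)
       & sigma = \sum_k (p k)%:C *: (a k *t b k)]].

Definition observable_basis d (F : 'I_(d ^ 2 - 1) -> 'M[R[i]]_d) : Prop :=
  [/\ forall i, F i \is hermsymmx,
      forall i, \tr (F i) = 0,
      forall i j, \tr (F i *m F j) = (i == j)%:R
    & forall i, opnorm (F i) <= 1].

(* The set {F_i^A (x) I} u {I (x) F_j^B}, enumerated by a disjoint sum; for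
   observable bases this enumeration is injective, so that sums over the set
   are sums over the index type. *)
Definition local_observable d (FA FB : 'I_(d ^ 2 - 1) -> 'M[R[i]]_d)
    (k : 'I_(d ^ 2 - 1) + 'I_(d ^ 2 - 1)) : 'M[R[i]]_(d * d) :=
  match k with
  | inl i => FA i *t 1%:M
  | inr j => 1%:M *t FB j
  end.

Definition cost d (FA FB : 'I_(d ^ 2 - 1) -> 'M[R[i]]_d) :
    'M[R[i]]_((d * d) * (d * d)) :=
  \sum_k (local_observable FA FB k *t 1%:M
          - 1%:M *t local_observable FA FB k) ^+ 2.

(* [Re] only casts to R: the trace is real since both factors are Hermitian. *)
Definition W1 d (FA FB : 'I_(d ^ 2 - 1) -> 'M[R[i]]_d)
    (rho sigma : 'M[R[i]]_(d * d)) : R :=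
  Num.sqrt (inf [set complex.Re (\tr (cost FA FB *m tau))
                | tau in coupling rho sigma]).

Definition wasserstein_entanglement d (FA FB : 'I_(d ^ 2 - 1) -> 'M[R[i]]_d)
    (rho : 'M[R[i]]_(d * d)) : R :=
  inf [set W1 FA FB rho sigma | sigma in @separable d].

(* The Haar (uniform) distribution on the unit sphere of C^n, characterized as
   the unitarily invariant Borel probability carried by the sphere. *)
Definition haar_sphere n (mu : probability (cvec R[i] n) R) : Prop :=
  mu [set psi : 'cV[R[i]]_n | l2norm psi = 1] = 1%E /\
  forall U : 'M[R[i]]_n, U \is unitarymx ->
    forall B : set (cvec R[i] n), measurable B ->
      mu [set psi : 'cV[R[i]]_n | B (U *m psi)] = mu B.

End States.

(* Main.v *)
(* The bound holds pointwise, with room to spare. Completeness of the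
   orthonormal family {F_i} u {I / sqrt d} gives, for each subsystem,
   \sum_i F_i^2 = (d - 1/d) I and \sum_i F_i (x) F_i = SWAP - I / d, hence
   C = 4d I - 2 SWAP_A - 2 SWAP_B. Since SWAP <= I, every coupling has cost at
   least 4(d - 1) >= 1, so E >= 1 >= pi/4 (1 - 1/d) on the whole unit sphere;
   integrating only uses that the law is carried by the sphere. *)
Require Import Defs.
From mathcomp Require Import all_boot all_order all_algebra.
From mathcomp Require Import all_classical all_reals all_analysis.
From mathcomp.real_closed Require Import complex mxtens.
From mathcomp Require Import fingroup perm ring lra.
Import Order.TTheory GRing.Theory Num.Theory.
Import numFieldNormedType.Exports.
Local Open Scope ring_scope.
Local Open Scope sesquilinear_scope.

(** * Indexing and traces of Kronecker products *)

Lemma sum_mxtens {V : nmodType} m n (f : 'I_(m * n) -> V) :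
  \sum_k f k = \sum_i \sum_j f (mxtens_index (i, j)).
Proof.
rewrite pair_big /= (reindex (@mxtens_index m n)) /=; last first.
  by exists (@mxtens_unindex m n) => ? _; rewrite (mxtens_indexK, mxtens_unindexK).
by apply: eq_bigr => -[i j].
Qed.

Lemma mxtens_index_eq m n (i i' : 'I_m) (j j' : 'I_n) :
  (mxtens_index (i, j) == mxtens_index (i', j')) = (i == i') && (j == j').
Proof. by rewrite (can_eq (@mxtens_indexK m n)) xpair_eqE. Qed.

Lemma mxtrace_tens {R : comPzRingType} m n (A : 'M[R]_m) (B : 'M[R]_n) :
  \tr (A *t B) = \tr A * \tr B.
Proof.
rewrite /mxtrace sum_mxtens mulr_suml; apply: eq_bigr => i _.
by rewrite mulr_sumr; apply: eq_bigr => j _; rewrite tensmxE.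
Qed.

(** Allows [m] and [n] to be equal only propositionally, as [1 + (d ^ 2 - 1)] and [d * d] are
    below. *)
Lemma mulmx1C_eq {R : comNzRingType} m n (A : 'M[R]_(m, n)) (B : 'M[R]_(n, m)) :
  m = n -> A *m B = 1%:M -> B *m A = 1%:M.
Proof. by move=> mn; move: A B; case: _ / mn => A B; exact: mulmx1C. Qed.

(** * Positive semidefinite matrices as Gram matrices *)

Section Gram.
Variable C : numClosedFieldType.

Lemma trmxC_mul m n p (A : 'M[C]_(m, n)) (B : 'M[C]_(n, p)) :
  (A *m B)^t* = B^t* *m A^t*.
Proof. by rewrite trmx_mul map_mxM. Qed.

Lemma mxtrace_gram_ge0 m n (B : 'M[C]_(m, n)) : 0 <= \tr (B^t* *m B).
Proof.
apply: sumr_ge0 => i _; rewrite mxE; apply: sumr_ge0 => j _.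
by rewrite !mxE mulrC mul_conjC_ge0.
Qed.

Lemma gram_form_ge0 m n (B : 'M[C]_(m, n)) (v : 'cV[C]_n) :
  0 <= (v^t* *m (B^t* *m B) *m v) 0 0.
Proof.
by rewrite mulmxA -trmxC_mul -mulmxA -trace_mx11 mxtrace_gram_ge0.
Qed.

Lemma gram_herm m n (B : 'M[C]_(m, n)) : B^t* *m B \is hermsymmx.
Proof. by apply/is_hermitianmxP; rewrite expr0 scale1r trmxC_mul trmxCK. Qed.

(** Spectral theorem: A = P^* D P with P unitary and D diagonal with nonnegative entries, so B =
    sqrt(D) P works. *)
Lemma psd_gram n (A : 'M[C]_n) : A \is hermsymmx ->
    (forall v : 'cV_n, 0 <= (v^t* *m A *m v) 0 0) ->
  exists B : 'M[C]_n, A = B^t* *m B.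
Proof.
move=> Aherm Apos.
have /orthomx_spectralP := hermitian_normalmx Aherm.
set P := spectralmx A; set D := spectral_diag A => AE.
have Pu : P \is unitarymx by exact: spectral_unitarymx.
rewrite (invmx_unitary Pu) in AE.
have D0 j : 0 <= D 0 j.
  (* At the eigenvector P^* e_j the quadratic form takes the eigenvalue [D 0 j] as its value. *)
  have := Apos (P^t* *m delta_mx j 0).
  rewrite trmxC_mul trmxCK {1}AE !mulmxA.
  move/unitarymxP : Pu => Pu.
  rewrite -[_ *m P *m P^t*]mulmxA Pu mulmx1.
  rewrite -[_ *m P *m P^t*]mulmxA Pu mulmx1.
  rewrite mxE (bigD1 j) //= big1 ?addr0; last first.
    by move=> k kj; rewrite [delta_mx _ _ k _]mxE (negbTE kj) mulr0.
  rewrite [delta_mx _ _ j _]mxE !eqxx mulr1 mxE (bigD1 j) //= big1 ?addr0.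
    by rewrite !mxE !eqxx conjC1 mul1r mulr1n.
  by move=> k kj; rewrite !mxE (negbTE kj) conjC0 mul0r.
exists (diag_mx (\row_j sqrtC (D 0 j)) *m P).
rewrite trmxC_mul -mulmxA [X in _ *m X]mulmxA AE -mulmxA; congr (_ *m (_ *m _)).
rewrite tr_diag_mx map_diag_mx mulmx_diag; congr diag_mx.
apply/rowP => j; rewrite !mxE.
have /CrealP cr : sqrtC (D 0 j) \is Num.real by rewrite ger0_real // sqrtC_ge0.
by rewrite [X in X * _]cr -expr2 sqrtCK.
Qed.

End Gram.

(** * Completeness of an orthonormal traceless family *)

(* The vectorized family [1 :: F], and its dual [1/d :: F^T], are mutually
   inverse square matrices; the identity is the product in the other order. *)
Lemma orthonormal_traceless_complete {K : fieldType} d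
    (F : 'I_(d ^ 2 - 1) -> 'M[K]_d) : (d%:R != 0 :> K) ->
    (forall i, \tr (F i) = 0) ->
    (forall i j, \tr (F i *m F j) = (i == j)%:R) ->
  forall a b c e, \sum_i F i a b * F i c e =
    (a == e)%:R * (b == c)%:R - (a == b)%:R * (c == e)%:R / d%:R.
Proof.
move=> d0 tr0 trd a b c e.
pose M := col_mx (\row_p ((mxtens_unindex p).1 == (mxtens_unindex p).2)%:R)
  (\matrix_(i, p) F i (mxtens_unindex p).1 (mxtens_unindex p).2) : 'M[K]_(_, d * d).
pose N := row_mx (\col_p (((mxtens_unindex p).1 == (mxtens_unindex p).2)%:R / d%:R))
  (\matrix_(p, i) F i (mxtens_unindex p).2 (mxtens_unindex p).1) : 'M[K]_(d * d, _).
have MN : M *m N = 1%:M.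
  have sdiag (f : 'I_d -> 'I_d -> K) : \sum_i \sum_j (i == j)%:R * f i j = \sum_i f i i.
    apply: eq_bigr => i _; rewrite (bigD1 i) //= big1 ?addr0 ?eqxx ?mul1r //.
    by move=> j /negbTE; rewrite eq_sym => ->; rewrite mul0r.
  (* The corner block is tr(I)/d = 1, the off-diagonal blocks are multiples of tr(F_i) = 0, and the
     last block is orthonormality. *)
  rewrite mul_col_row scalar_mx_block; congr block_mx; apply/matrixP => i j;
    rewrite !mxE sum_mxtens.
  - under eq_bigr do under eq_bigr do rewrite !mxE !mxtens_indexK /=.
    rewrite sdiag !ord1 eqxx; under eq_bigr do rewrite eqxx mul1r.
    by rewrite sumr_const card_ord -[d%:R^-1 *+ d]mulr_natr mulVf.
  - under eq_bigr do under eq_bigr do rewrite !mxE !mxtens_indexK /=.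
    by rewrite sdiag -[RHS](tr0 j).
  - under eq_bigr do under eq_bigr do rewrite !mxE !mxtens_indexK /= mulrCA.
    by rewrite sdiag -mulr_suml -[X in X * _]/(\tr (F i)) tr0 mul0r.
  - under eq_bigr do under eq_bigr do rewrite !mxE !mxtens_indexK /=.
    by rewrite -trd /mxtrace; apply: eq_bigr => k _; rewrite mxE.
have d_gt0 : (0 < d)%N by case: d d0 {F tr0 trd a b c e M N MN} => //; rewrite eqxx.
have dd : (1 + (d ^ 2 - 1) = d * d)%N by rewrite subnKC ?expn_gt0 ?d_gt0 // mulnn.
move: (mulmx1C_eq _ _ _ _ dd MN).
(* [N] stores the transposes of the F_i, so its row (b, a) holds the entries [F i a b]. *)
move/matrixP/(_ (mxtens_index (b, a)) (mxtens_index (c, e))).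
rewrite mul_row_col !mxE big_ord_recl big_ord0 addr0 !mxE !mxtens_indexK.
under eq_bigr do rewrite !mxE !mxtens_indexK /=.
rewrite mxtens_index_eq => /(canRL (addKr _)) ->.
by rewrite -mulnb natrM [b == a]eq_sym; ring.
Qed.

(** * Density matrices, separable states and couplings *)

Section Density.
Variable R : realType.

Lemma density_gram m n (B : 'M[R[i]]_(m, n)) :
  \tr (B^t* *m B) = 1 -> density (B^t* *m B).
Proof.
by move=> tr1; split=> //; [exact: gram_herm | move=> v; exact: gram_form_ge0].
Qed.

Lemma densityP n (A : 'M[R[i]]_n) :
  density A -> exists2 B : 'M[R[i]]_n, A = B^t* *m B & \tr (B^t* *m B) = 1.
Proof. by move=> [Ah Ap tr1]; have [B AE] := psd_gram _ _ _ Ah Ap; exists B; rewrite -?AE. Qed.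

(** Gram factors tensor: X^*X (x) Y^*Y = (X (x) Y)^* (X (x) Y). *)
Lemma density_tens m n (A : 'M[R[i]]_m) (B : 'M[R[i]]_n) :
  density A -> density B -> density (A *t B).
Proof.
move=> /densityP[X -> trX] /densityP[Y -> trY].
rewrite -tensmx_mul -map_mxT -trmx_tens.
by apply: density_gram; rewrite trmx_tens map_mxT tensmx_mul mxtrace_tens trX trY mulr1.
Qed.

Lemma density_convex n m (p : 'I_n -> R) (A : 'I_n -> 'M[R[i]]_m) :
    (forall k, 0 <= p k) -> \sum_k p k = 1 -> (forall k, density (A k)) ->
  density (\sum_k (p k)%:C%C *: A k).
Proof.
move=> p0 p1 dA; split.
- apply/is_hermitianmxP; rewrite expr0 scale1r; apply/matrixP => i j.
  rewrite summxE !mxE summxE rmorph_sum; apply: eq_bigr => k _.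
  have [/is_hermitianmxP Ah _ _] := dA k.
  rewrite !mxE rmorphM /= [in LHS]Ah expr0 scale1r !mxE; congr (_ * _).
  by rewrite [RHS]conj_Creal // complex_real.
- move=> v; rewrite mulmx_sumr mulmx_suml summxE; apply: sumr_ge0 => k _.
  rewrite -scalemxAr -scalemxAl mxE mulr_ge0 ?ler0c //.
  by have [_ Ak _] := dA k; exact: Ak.
- have trA k : \tr (A k) = 1 by have [] := dA k.
  rewrite raddf_sum /=; under eq_bigr do rewrite mxtraceZ trA mulr1.
  by rewrite -rmorph_sum p1.
Qed.

Lemma density_delta n (i : 'I_n) : density (delta_mx i i : 'M[R[i]]_n).
Proof.
have E : delta_mx i i = (delta_mx i i : 'M[R[i]]_n)^t* *m delta_mx i i.
  by rewrite trmx_delta map_delta_mx mul_delta_mx.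
rewrite E; apply: density_gram; rewrite -E /mxtrace (bigD1 i) //= big1 ?addr0.
  by rewrite mxE !eqxx.
by move=> k ki; rewrite mxE (negbTE ki).
Qed.

Lemma separable_density d (sigma : 'M[R[i]]_(d * d)) :
  separable sigma -> density sigma.
Proof.
move=> [n [p [a [b [p0 p1 dab ->]]]]]; apply: density_convex => // k.
by have [da db] := dab k; exact: density_tens.
Qed.

(** A positive lower bound passes to [inf] only over a nonempty set, since [inf] of the empty set is
    0; the state |00><00| is a witness. *)
Lemma separable_nonempty d : (0 < d)%N -> (@separable R d !=set0)%classic.
Proof.
case: d => // d _; pose D := delta_mx ord0 ord0 : 'M[R[i]]_d.+1.
exists (\sum_(k < 1) 1%:C%C *: (D *t D)).
exists 1%N, (fun=> 1), (fun=> D), (fun=> D); split=> //; first by rewrite big_ord1.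
by move=> _; split; exact: density_delta.
Qed.

Lemma l2norm_sqr n (v : 'cV[R[i]]_n) :
  (l2norm v ^+ 2)%:C%C = \sum_i `|v i 0| ^+ 2.
Proof.
rewrite /l2norm sqr_sqrtr; last by apply: sumr_ge0 => i _; rewrite sqr_ge0.
by rewrite rmorph_sum; apply: eq_bigr => i _; rewrite rmorphXn.
Qed.

Lemma pure_state_density n (psi : 'cV[R[i]]_n) :
  l2norm psi = 1 -> density (pure_state psi).
Proof.
move=> psi1; rewrite /pure_state -{1}[psi](@trmxCK R[i]); apply: density_gram.
rewrite trmxCK mxtrace_mulC trace_mx11 mxE.
transitivity ((l2norm psi ^+ 2)%:C%C); last by rewrite psi1 expr1n.
by rewrite l2norm_sqr; apply: eq_bigr => i _; rewrite !mxE mulrC normCK.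
Qed.

(** Supplies the same nonemptiness for the infimum inside [W1]. *)
Lemma coupling_tens n (rho sigma : 'M[R[i]]_n) :
  density rho -> density sigma -> coupling rho sigma (rho *t sigma).
Proof.
move=> dr ds; split; first exact: density_tens.
- apply/matrixP => i j; rewrite !mxE; under eq_bigr do rewrite tensmxE.
  by case: ds => _ _ trs; rewrite -mulr_sumr -[X in _ * X]/(\tr sigma) trs mulr1.
- apply/matrixP => i j; rewrite !mxE; under eq_bigr do rewrite tensmxE.
  by case: dr => _ _ trs; rewrite -mulr_suml -[X in X * _]/(\tr rho) trs mul1r.
Qed.

(* For an involution [1 - S = (1 - S)^2 / 2], a positive operator. *)
Lemma mxtrace_swap_le1 n (s : {perm 'I_n}) (tau : 'M[R[i]]_n) :
  (s * s = 1)%g -> density tau -> \tr (perm_mx s *m tau) <= 1.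
Proof.
move=> ss dtau; have [_ _ tr1] := dtau.
have [B tauE _] := densityP _ _ dtau.
set S : 'M[R[i]]_n := perm_mx s.
have SS : S *m S = 1%:M by rewrite -perm_mxM ss perm_mx1.
have SC : S^t* = S.
  by rewrite tr_perm_mx map_perm_mx; congr perm_mx; apply/eqP; rewrite eq_invg_mul ss.
have := mxtrace_gram_ge0 _ _ _ (B *m (1%:M - S)).
rewrite trmxC_mul mulmxA -[_ *m _ *m B]mulmxA -tauE mxtrace_mulC mulmxA.
have -> : (1%:M - S)^t* = 1%:M - S.
  by rewrite linearB /= map_mxB SC trmx1 map_mx1.
have -> : (1%:M - S) *m (1%:M - S) = (1%:M - S) *+ 2.
  rewrite mulmxBl !mulmxBr !mulmx1 SS mul1mx mulr2n.
  by rewrite opprB addrA addrAC -addrA.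
rewrite mulr2n mulmxDl linearD /= mulmxBl mul1mx linearB /= tr1 -mulr2n.
by rewrite pmulrn_lge0 // subr_ge0.
Qed.

End Density.

(** * The cost operator in terms of swaps *)

Section Cost.
Variables (R : realType) (d : nat).

(** Basis vector of the two copies: [a], [b] are the A and B indices of the first copy, [c], [e]
    those of the second. *)
Definition quad (a b c e : 'I_d) : 'I_((d * d) * (d * d)) :=
  mxtens_index (mxtens_index (a, b), mxtens_index (c, e)).

Lemma quad_eq a b c e a' b' c' e' :
  (quad a b c e == quad a' b' c' e') =
  [&& a == a', b == b', c == c' & e == e'].
Proof. by rewrite /quad !mxtens_index_eq -!andbA. Qed.

Definition swapA_fun (p : 'I_((d * d) * (d * d))) :=
  let l := mxtens_unindex (mxtens_unindex p).1 in
  let r := mxtens_unindex (mxtens_unindex p).2 in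
  quad r.1 l.2 l.1 r.2.

Definition swapB_fun (p : 'I_((d * d) * (d * d))) :=
  let l := mxtens_unindex (mxtens_unindex p).1 in
  let r := mxtens_unindex (mxtens_unindex p).2 in
  quad l.1 r.2 r.1 l.2.

Lemma swapA_quad a b c e : swapA_fun (quad a b c e) = quad c b a e.
Proof. by rewrite /swapA_fun {1 2 3 4}/quad !mxtens_indexK. Qed.

Lemma swapB_quad a b c e : swapB_fun (quad a b c e) = quad a e c b.
Proof. by rewrite /swapB_fun {1 2 3 4}/quad !mxtens_indexK. Qed.

Variant quad_spec : 'I_((d * d) * (d * d)) -> Type :=
  QuadSpec a b c e : quad_spec (quad a b c e).

Lemma quadP p : quad_spec p.
Proof.
by case: (mxtens_indexP p) => l r; case: (mxtens_indexP l) => ? ?;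
  case: (mxtens_indexP r) => ? ?; constructor.
Qed.

Lemma swapA_funK : involutive swapA_fun.
Proof. by move=> p; case: (quadP p) => a b c e; rewrite !swapA_quad. Qed.

Lemma swapB_funK : involutive swapB_fun.
Proof. by move=> p; case: (quadP p) => a b c e; rewrite !swapB_quad. Qed.

Definition swapA := perm (inv_inj swapA_funK).
Definition swapB := perm (inv_inj swapB_funK).

Lemma swapA_sqr : (swapA * swapA = 1)%g.
Proof. by apply/permP => p; rewrite permM !permE swapA_funK. Qed.

Lemma swapB_sqr : (swapB * swapB = 1)%g.
Proof. by apply/permP => p; rewrite permM !permE swapB_funK. Qed.

(** X (x) I and I (x) X commute, so both cross terms equal X (x) X. *)
Lemma sqr_tens_sub n (X : 'M[R[i]]_n) :
  (X *t 1%:M - 1%:M *t X) ^+ 2 =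
  (X *m X) *t 1%:M + 1%:M *t (X *m X) - (X *t X) *+ 2.
Proof.
rewrite expr2 -[LHS]/(_ *m _) mulmxBl !mulmxBr !tensmx_mul !mulmx1 !mul1mx.
by rewrite opprB addrACA -opprD -mulr2n.
Qed.

Lemma mx1_quad a b c e a' b' c' e' :
  (1%:M : 'M[R[i]]_((d * d) * (d * d))) (quad a b c e) (quad a' b' c' e') =
  (a == a')%:R * (b == b')%:R * (c == c')%:R * (e == e')%:R.
Proof. by rewrite mxE quad_eq !andbA -!mulnb !natrM. Qed.

(** Contracts the two inner indices of the completeness relation; this is the Casimir identity. *)
Lemma sum_sqr_observable (F : 'I_(d ^ 2 - 1) -> 'M[R[i]]_d) :
    (0 < d)%N -> observable_basis F -> forall a b,
  \sum_i (F i *m F i) a b = (d%:R - d%:R^-1) * (a == b)%:R.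
Proof.
move=> d_gt0 [_ tr0 trd _] a b.
under eq_bigr do rewrite mxE.
rewrite exchange_big /=.
have d0 : d%:R != 0 :> R[i] by rewrite pnatr_eq0 -lt0n.
under eq_bigr do rewrite (orthonormal_traceless_complete _ _ d0 tr0 trd) eqxx mulr1.
rewrite sumrB sumr_const card_ord -mulr_suml (bigD1 a) //= big1 ?addr0; last first.
  by move=> k /negbTE; rewrite eq_sym => ->; rewrite mul0r.
by rewrite eqxx mulr1n mul1r -[X in X - _]mulr_natr; ring.
Qed.

(** Each subsystem contributes 2(d - 1/d) I from the squares and -2(SWAP - I/d) from the cross
    terms; the 1/d parts cancel, leaving 2d I - 2 SWAP. *)
Lemma costE (FA FB : 'I_(d ^ 2 - 1) -> 'M[R[i]]_d) :
    (0 < d)%N -> observable_basis FA -> observable_basis FB ->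
  cost FA FB = (4 * d%:R)%:M - perm_mx swapA *+ 2 - perm_mx swapB *+ 2.
Proof.
move=> d_gt0 hA hB.
have sqA := sum_sqr_observable _ d_gt0 hA.
have sqB := sum_sqr_observable _ d_gt0 hB.
have d0 : d%:R != 0 :> R[i] by rewrite pnatr_eq0 -lt0n.
have [_ trA trA2 _] := hA; have [_ trB trB2 _] := hB.
have cA := orthonormal_traceless_complete _ _ d0 trA trA2.
have cB := orthonormal_traceless_complete _ _ d0 trB trB2.
(* One entry rule per operation: a blanket [mxE] would also unfold the products [F i *m F i], which
   must stay intact for [sqA] and [sqB]. *)
have addE m n (A B : 'M[R[i]]_(m, n)) i j : (A + B) i j = A i j + B i j by rewrite mxE.
have oppE m n (A : 'M[R[i]]_(m, n)) i j : (- A) i j = - A i j by rewrite mxE.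
have oneE n (i j : 'I_n) : (1%:M : 'M[R[i]]_n) i j = (i == j)%:R by rewrite mxE.
have scaleE m n k (A : 'M[R[i]]_(m, n)) i j : (k *: A) i j = k * A i j by rewrite mxE.
have permE' n (s : 'S_n) i j : (perm_mx s : 'M[R[i]]_n) i j = (s i == j)%:R.
  by rewrite mxE mxE.
rewrite /cost; under eq_bigr do rewrite sqr_tens_sub.
apply/matrixP => p q.
case: (quadP p) => a b c e; case: (quadP q) => a' b' c' e'.
have tA i : ((FA i *t 1%:M *m (FA i *t 1%:M)) *t 1%:M
   + 1%:M *t (FA i *t 1%:M *m (FA i *t 1%:M))
   - (FA i *t 1%:M *t (FA i *t 1%:M)) *+ 2) (quad a b c e) (quad a' b' c' e')
  = (FA i *m FA i) a a' * ((b == b')%:R * (c == c')%:R * (e == e')%:R)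
  + (FA i *m FA i) c c' * ((b == b')%:R * (a == a')%:R * (e == e')%:R)
  - (FA i a a' * FA i c c') * (2 * (b == b')%:R * (e == e')%:R).
  rewrite !tensmx_mul mulmx1 mulr2n !(addE, oppE) !tensmxE !oneE !mxtens_index_eq.
  by rewrite -!mulnb !natrM; ring.
have tB i : ((1%:M *t FB i *m (1%:M *t FB i)) *t 1%:M
   + 1%:M *t (1%:M *t FB i *m (1%:M *t FB i))
   - (1%:M *t FB i *t (1%:M *t FB i)) *+ 2) (quad a b c e) (quad a' b' c' e')
  = (FB i *m FB i) b b' * ((a == a')%:R * (c == c')%:R * (e == e')%:R)
  + (FB i *m FB i) e e' * ((b == b')%:R * (a == a')%:R * (c == c')%:R)
  - (FB i b b' * FB i e e') * (2 * (a == a')%:R * (c == c')%:R).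
  rewrite !tensmx_mul mulmx1 mulr2n !(addE, oppE) !tensmxE !oneE !mxtens_index_eq.
  by rewrite -!mulnb !natrM; ring.
rewrite summxE big_sumType /=.
under eq_bigr do rewrite tA.
under [X in _ + X]eq_bigr do rewrite tB.
rewrite !(sumrB, big_split) /= -!mulr_suml !sqA !sqB cA cB.
rewrite -[(4 * d%:R)%:M]scalemx1 !mulr2n !(addE, oppE) scaleE oneE !permE'.
rewrite !permE swapA_quad swapB_quad !quad_eq -!mulnb !natrM.
(* Orients the swap deltas as the completeness relation produces them. *)
rewrite [c == a']eq_sym [e == b']eq_sym.
by field.
Qed.

Lemma mxtrace_cost_ge (FA FB : 'I_(d ^ 2 - 1) -> 'M[R[i]]_d) tau :
    (0 < d)%N -> observable_basis FA -> observable_basis FB -> density tau ->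
  4 * (d%:R - 1) <= complex.Re (\tr (cost FA FB *m tau)).
Proof.
move=> d_gt0 hA hB dtau; have [_ _ tr1] := dtau.
have sA := mxtrace_swap_le1 _ _ _ _ swapA_sqr dtau.
have sB := mxtrace_swap_le1 _ _ _ _ swapB_sqr dtau.
(* An inequality in [R[i]] compares real parts, so the bound can be proved on the complex trace. *)
have le_Re (x : R) (z : R[i]) : x%:C%C <= z -> x <= complex.Re z.
  by case: z => u v; rewrite lecE => /andP[].
apply: le_Re; rewrite costE // !mulr2n !mulmxBl !mulmxDl mul_scalar_mx.
rewrite !linearB !linearD /= mxtraceZ tr1 rmorphM rmorphB !rmorph_nat rmorph1 -subr_ge0.
set x := \tr _ in sA *; set y := \tr _ in sB *.
rewrite (_ : _ - _ = (1 - x) *+ 2 + (1 - y) *+ 2); last by ring.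
by rewrite addr_ge0 // mulrn_wge0 // subr_ge0.
Qed.

(** * Pointwise bounds on the entanglement measure *)

Lemma wasserstein_entanglement_ge1 (FA FB : 'I_(d ^ 2 - 1) -> 'M[R[i]]_d) psi :
    (2 <= d)%N -> observable_basis FA -> observable_basis FB ->
  l2norm psi = 1 -> 1 <= wasserstein_entanglement FA FB (pure_state psi).
Proof.
move=> d_ge2 hA hB psi1; have d_gt0 := ltnW d_ge2.
apply: lb_le_inf.
  have [sigma sep] := separable_nonempty R d d_gt0.
  by exists (W1 FA FB (pure_state psi) sigma), sigma.
move=> _ [sigma /separable_density dsigma <-].
(* Writing 1 as its own square root reduces the claim to a cost of at least 1 for every coupling. *)
rewrite -[X in X <= _]sqrtr1 ler_wsqrtr //.
apply: lb_le_inf.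
  exists (complex.Re (\tr (cost FA FB *m (pure_state psi *t sigma)))).
  exists (pure_state psi *t sigma) => //.
  exact: coupling_tens (pure_state_density _ _ _ psi1) dsigma.
move=> _ [tau [dtau _ _] <-].
apply: le_trans (mxtrace_cost_ge _ _ _ d_gt0 hA hB dtau).
have : (2%:R <= d%:R :> R) by rewrite ler_nat.
by lra.
Qed.

(** Holds for every matrix [rho]: the expectation bound needs nonnegativity off the sphere as
    well. *)
Lemma wasserstein_entanglement_ge0 (FA FB : 'I_(d ^ 2 - 1) -> 'M[R[i]]_d) rho :
  (0 < d)%N -> 0 <= wasserstein_entanglement FA FB rho.
Proof.
move=> d_gt0; apply: lb_le_inf.
  have [sigma sep] := separable_nonempty R d d_gt0.
  by exists (W1 FA FB rho sigma), sigma.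
by move=> _ [sigma _ <-]; exact: sqrtr_ge0.
Qed.
End Cost.

(** * Measurability of the sphere and integration *)

(** The sphere is closed, as a level set of a continuous function; [K] stays abstract because [R[i]]
    gets its topology as a [numFieldType]. *)
Lemma measurable_sum_sqr_norm_eq1 (K : numFieldType) n :
  measurable ([set v | \sum_i `|v i 0| ^+ 2 = 1]%classic : set (cvec K n)).
Proof.
have cf : continuous (fun v : 'cV[K]_n => \sum_i `|v i 0| ^+ 2).
  apply: continuous_big; first exact: add_continuous.
  move=> i _ v; apply: (@continuous_comp _ _ _
    (fun v : 'cV[K]_n => v i 0) (fun x : K => `|x| * `|x|)).
    exact: coord_continuous.
  exact: cvgM (@norm_continuous K K^o (v i 0)) (@norm_continuous K K^o (v i 0)).
have cl1 : closed ([set 1]%classic : set K).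
  exact: (@accessible_closed_set1 K (@hausdorff_accessible K (@norm_hausdorff K K^o))).
have /closed_openC openC := @preimage_closed _ _ _ _ (fun v _ => cf v) cl1.
by rewrite -[X in measurable X]setCK; apply: measurableC; exact: sub_sigma_algebra.
Qed.

Lemma measurable_sphere (R : realType) n :
  measurable ([set psi | l2norm psi = 1]%classic : set (cvec R[i] n)).
Proof.
have := measurable_sum_sqr_norm_eq1 R[i] n; congr measurable.
apply/seteqP; split => v /=; rewrite -l2norm_sqr; last by move=> ->; rewrite expr1n.
by move=> /complexI E; apply/eqP; rewrite -sqrp_eq1 ?sqrtr_ge0 // E.
Qed.

(* [X] may fail to be measurable: the integral of a nonnegative function is
   the supremum of the integrals of the simple functions below it. *)
Lemma le_expectation_indic d (T : measurableType d) (R : realType)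
    (P : probability T R) (X : T -> R) (A : set T) :
    measurable A -> (forall x, 0 <= X x) -> (forall x, A x -> 1 <= X x) ->
  (P A <= 'E_P[X])%E.
Proof.
move=> mA X0 X1; rewrite unlock ge0_integralTE; last by move=> x; rewrite lee_fin.
apply: ereal_sup_ubound; exists (indic_nnsfun R mA); last exact: sintegral_indic.
move=> x; rewrite lee_fin -[leLHS]/(\1_A x) indicE.
by have [/set_mem/X1|_] := boolP (x \in A).
Qed.

Theorem theorem14 (R : realType) (d : nat) (hd : (2 <= d)%N)
    (FA FB : 'I_(d ^ 2 - 1) -> 'M[R[i]]_d)
    (hA : observable_basis FA) (hB : observable_basis FB)
    (mu : probability (cvec R[i] (d * d)) R) (hmu : haar_sphere mu) :
  ((pi / 4 * (1 - d%:R^-1))%:E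
     <= 'E_mu[fun psi : cvec R[i] (d * d) =>
                wasserstein_entanglement FA FB (pure_state psi)])%E.
Proof.
have [mu1 _] := hmu.
apply: (@le_trans _ _ (mu [set psi : 'cV[R[i]]_(d * d) | l2norm psi = 1]%classic)).
  rewrite mu1 lee_fin.
  (* From pi/2 < 2. *)
  have pi4 : pi / 4 <= 1 :> R by have := pihalf_lt2 R; lra.
  have dV : 0 <= d%:R^-1 :> R by rewrite invr_ge0 ler0n.
  have := pi_ge0 R; nra.
apply: le_expectation_indic; first exact: measurable_sphere.
  by move=> psi; exact: wasserstein_entanglement_ge0 (ltnW hd).
by move=> psi psi1; exact: wasserstein_entanglement_ge1.
Qed.
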